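(* Let $k$ be a field of characteristic $p\neq 0$. The functor $U_p: p\text{-}\mathrm{preLie}\to\mathrm{Dend}$, $P\mapsto U_p(P)$, is left adjoint to the functor $(-)_{p\text{-}\mathrm{preLie}}:\mathrm{Dend}\to p\text{-}\mathrm{preLie}$. Therefore, for every restricted pre-Lie algebra $P$ and every dendriform algebra $A$ over $k$, there is a natural bijection $$\mathrm{Hom}_{p\text{-}\mathrm{preLie}}(P,A_{p\text{-}\mathrm{preLie}})\simeq\mathrm{Hom}_{\mathrm{Dend}}(U_p(P),A).$$
   Context: A dendriform algebra over a field $k$ is a $k$-vector space $D$ with two bilinear operations $\prec,\succ: D\times D\to D$ such that for all $x,y,z\in D$: $(x\prec y)\prec z=x\prec(y\prec z+y\succ z)$, $(x\succ y)\prec z=x\succ(y\prec z)$, $(x\prec y+x\succ y)\succ z=x\succ(y\succ z)$. Then $x\star y:=x\prec y+x\succ y$ is associative; $x^{\star p}$ denotes the $p$-th power for $\star$. $\mathrm{Dend}$ is the category of dendriform algebras over $k$. A (left) pre-Lie algebra is a $k$-vector space $P$ with a bilinear operation $\{-,-\}:P\times P\to P$ such that $\{x,\{y,z\}\}-\{\{x,y\},z\}=\{y,\{x,z\}\}-\{\{y,x\},z\}$ for all $x,y,z\in P$. Then $[x,y]:=\{x,y\}-\{y,x\}$ is a Lie bracket on $P$. A restricted pre-Lie algebra over a field $k$ of characteristic $p\neq 0$ is a pre-Lie algebra $(P,\{-,-\})$ over $k$ together with a map $(-)^{[p]}:P\to P$ (the $p$-map) such that for all $x,y\in P$, $\alpha\in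 k$: (1) $(\alpha x)^{[p]}=\alpha^p x^{[p]}$; (2) $\{x^{[p]},y\}=\{x,\{x,\cdots\{x,y\}\cdots\}\}$ ($p$ copies of $x$); (3) $\{y,x^{[p]}\}=\{x,\{x,\cdots\{x,y\}\cdots\}\}-[x,[x,\cdots[x,y]\cdots]]$ ($p$ copies of $x$ in each term); (4) $(x+y)^{[p]}=x^{[p]}+y^{[p]}+\sum_{i=1}^{p-1}s_i(x,y)$, where $i\,s_i(x,y)$ is the coefficient of $\lambda^{i-1}$ in $[\lambda x+y,[\cdots,[\lambda x+y,x]\cdots]]$ with $p-1$ copies of $\lambda x+y$ ($\lambda$ a formal variable). Morphisms of restricted pre-Lie algebras are pre-Lie morphisms $f$ with $f(x^{[p]})=f(x)^{[p]}$; the category is denoted $p\text{-}\mathrm{preLie}$. For a dendriform algebra $A$, $A_{p\text{-}\mathrm{preLie}}$ is the restricted pre-Lie algebra with underlying space $A$, product $\{x,y\}:=x\succ y-y\prec x$ and $p$-map $x\mapsto x^{\star p}$; this defines the functor $(-)_{p\text{-}\mathrm{preLie}}:\mathrm{Dend}\to p\text{-}\mathrm{preLie}$ (identity on maps). For a restricted pre-Lie algebra $(P,\{-,-\},(-)^{[p]})$, let $\mathrm{Dend}(P)$ be the free dendriform algebra generated by the vector space $P$, and let $\mathcal R_p$ be the dendriform (two-sided, for both operations) ideal of $\mathrm{Dend}(P)$ generated by the elements $\{x,y\}-(x\succ y-y\prec x)$ and $x^{[p]}-x^{\star p}$ for $x,y\in P$ (with $\{x,y\}$ and $x^{[p]}$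 computed in $P\subset\mathrm{Dend}(P)$). Put $U_p(P):=\mathrm{Dend}(P)/\mathcal R_p$. *)

(* Defs.v *)
From HB Require Import structures.
From mathcomp Require Import all_boot all_order all_algebra.
From mathcomp Require Import sesquilinear generic_quotient ring_quotient.
From mathcomp Require Import boolp.

Set Implicit Arguments.
Unset Strict Implicit.
Unset Printing Implicit Defensive.

Import GRing.Theory.
Local Open Scope ring_scope.
Local Open Scope quotient_scope.

Reserved Notation "x ≺ y" (at level 40, left associativity).
Reserved Notation "x ≻ y" (at level 40, left associativity).
Reserved Notation "x ⋆ y" (at level 40, left associativity).

HB.mixin Record Lmodule_isDendriform (k : fieldType) D of GRing.Lmodule k D := {
  dprec : D -> D -> D;
  dsucc : D -> D -> D;
  dprec_bilinear : bilinear_for *:%R *:%R dprec;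
  dsucc_bilinear : bilinear_for *:%R *:%R dsucc;
  dprecA : forall x y z,
    dprec (dprec x y) z = dprec x (dprec y z + dsucc y z);
  dsuccprecA : forall x y z, dprec (dsucc x y) z = dsucc x (dprec y z);
  dsuccA : forall x y z,
    dsucc (dprec x y + dsucc x y) z = dsucc x (dsucc y z)
}.

#[short(type="dendType")]
HB.structure Definition Dendriform (k : fieldType) :=
  {D of GRing.Lmodule k D & Lmodule_isDendriform k D}.

Notation "x ≺ y" := (dprec x y) : ring_scope.
Notation "x ≻ y" := (dsucc x y) : ring_scope.

Definition dstar (k : fieldType) (D : dendType k) (x y : D) : D :=
  x ≺ y + x ≻ y.
Notation "x ⋆ y" := (dstar x y) : ring_scope.

(* The n-th power for ⋆, which has no unit: only meaningful for n > 0. *)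
Definition dpow (k : fieldType) (D : dendType k) (x : D) (n : nat) : D :=
  iter n.-1 (dstar x) x.

HB.mixin Record Lmodule_isPreLie (k : fieldType) P of GRing.Lmodule k P := {
  plmul : P -> P -> P;
  plmul_bilinear : bilinear_for *:%R *:%R plmul;
  plmul_prelie : forall x y z,
    plmul x (plmul y z) - plmul (plmul x y) z =
    plmul y (plmul x z) - plmul (plmul y x) z
}.

#[short(type="preLieType")]
HB.structure Definition PreLie (k : fieldType) :=
  {P of GRing.Lmodule k P & Lmodule_isPreLie k P}.

Definition plbr (k : fieldType) (P : preLieType k) (x y : P) : P :=
  plmul x y - plmul y x.

Section Jacobson.
Variables (k : fieldType) (P : preLieType k).

(* An element of P[λ] is encoded by its sequence of coefficients nat -> P;
   the bracket of P is extended λ-bilinearly, i.e. by Cauchy product. *)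
Definition lam_br (f g : nat -> P) (n : nat) : P :=
  \sum_(i < n.+1) plbr (f i) (g (n - i)%N).
Definition lam_const (x : P) (n : nat) : P := if n is 0 then x else 0.
Definition lam_lin (x y : P) (n : nat) : P :=
  match n with 0 => y | 1 => x | _ => 0 end.

(* i * s_i(x, y) is the coefficient of λ^(i-1) in ad(λ x + y)^(p-1) (x);
   used for 0 < i < p, where i is invertible in characteristic p. *)
Definition jacobson_s (p i : nat) (x y : P) : P :=
  (i%:R : k)^-1 *: iter p.-1 (lam_br (lam_lin x y)) (lam_const x) i.-1.

End Jacobson.

HB.mixin Record PreLie_isRestricted (k : fieldType) (p : nat) P
    of PreLie k P := {
  p_map : P -> P;
  p_mapZ : forall (a : k) (x : P), p_map (a *: x) = a ^+ p *: p_map x;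
  plmul_pmapl : forall x y : P, plmul (p_map x) y = iter p (plmul x) y;
  plmul_pmapr : forall x y : P,
    plmul y (p_map x) = iter p (plmul x) y - iter p (plbr x) y;
  p_mapD : forall x y : P,
    p_map (x + y) = p_map x + p_map y + \sum_(1 <= i < p) jacobson_s p i x y
}.

(* Only meaningful when p is the characteristic of k: this is not imposed on
   the structure, and pPreLie_of takes it as an argument. *)
#[short(type="rPreLieType")]
HB.structure Definition RPreLie (k : fieldType) (p : nat) :=
  {P of PreLie k P & PreLie_isRestricted k p P}.

Section DendriformTheory.
Variables (k : fieldType) (D : dendType k).
Implicit Types (x y z : D) (a : k).

HB.instance Definition _ :=
  bilinear_isBilinear.Build k D D D *:%R *:%R (@dprec k D) dprec_bilinear.
HB.instance Definition _ :=
  bilinear_isBilinear.Build k D D D *:%R *:%R (@dsucc k D) dsucc_bilinear.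

Lemma dstar_bilinear : bilinear_for *:%R *:%R (@dstar k D).
Proof.
split=> u a v w /=; rewrite /dstar.
  by rewrite (dprec_bilinear.1 u) (dsucc_bilinear.1 u) /= scalerDr addrACA.
by rewrite (dprec_bilinear.2 u) (dsucc_bilinear.2 u) /= scalerDr addrACA.
Qed.

HB.instance Definition _ :=
  bilinear_isBilinear.Build k D D D *:%R *:%R (@dstar k D) dstar_bilinear.

Lemma dstarA x y z : (x ⋆ y) ⋆ z = x ⋆ (y ⋆ z).
Proof.
rewrite [LHS]/dstar dsuccA linearDl /= dprecA dsuccprecA -/(dstar y z).
by rewrite -addrA -linearDr.
Qed.

Lemma dpowS x n : (0 < n)%N -> dpow x n.+1 = x ⋆ dpow x n.
Proof. by case: n. Qed.

Lemma dsucc_dpow x n y : (0 < n)%N -> dpow x n ≻ y = iter n (dsucc x) y.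
Proof.
elim: n => // n IHn _; case: n IHn => // n IHn.
by rewrite dpowS // [RHS]iterS -IHn // -dsuccA.
Qed.

Lemma dprec_dpow x n y :
  (0 < n)%N -> y ≺ dpow x n = iter n (fun z => z ≺ x) y.
Proof.
elim: n y => // n IHn y _; case: n IHn => // n IHn.
by rewrite dpowS // [RHS]iterSr -IHn // dprecA.
Qed.

Lemma dstar_dpowl x n y : (0 < n)%N -> dpow x n ⋆ y = iter n (dstar x) y.
Proof.
elim: n => // n IHn _; case: n IHn => // n IHn.
by rewrite dpowS // [RHS]iterS -IHn // -dstarA.
Qed.

Lemma dstar_dpowr x n y :
  (0 < n)%N -> y ⋆ dpow x n = iter n (fun z => z ⋆ x) y.
Proof.
elim: n y => // n IHn y _; case: n IHn => // n IHn.
by rewrite dpowS // [RHS]iterSr -IHn // dstarA.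
Qed.

Lemma dpowZ a x n : (0 < n)%N -> dpow (a *: x) n = a ^+ n *: dpow x n.
Proof.
elim: n => // n IHn _; case: n IHn => // n IHn.
by rewrite dpowS // IHn // linearZl_LR /= linearZr /= scalerA -exprS [in RHS]dpowS.
Qed.

End DendriformTheory.

Section CommutingDifference.
Variables (V : zmodType) (f g : {additive V -> V}).
Hypothesis fgC : forall v, f (g v) = g (f v).

Let iter_gf n v : g (iter n f v) = iter n f (g v).
Proof. by elim: n => //= n IHn; rewrite -fgC IHn. Qed.

Lemma iter_sub n v :
  iter n (fun u => f u - g u) v =
  \sum_(i < n.+1) (iter i f (iter (n - i) g v)) *~ ((-1) ^+ (n - i) * 'C(n, i)%:Z).
Proof.
elim: n => [|n IHn]; first by rewrite big_ord1 /= mulr1z.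
rewrite iterS IHn !raddf_sum /=.
under eq_bigr => i _ do rewrite raddfMz -iterS.
rewrite [X in _ + X](eq_bigr (fun i : 'I_n.+1 => iter i f (iter (n.+1 - i) g v) *~
   ((-1) ^+ (n.+1 - i) * 'C(n, i)%:Z))); last first.
  move=> i _; rewrite raddfMz -mulNrz subSn -1?ltnS // exprS mulN1r mulNr mulrNz.
  by rewrite mulNrz iter_gf -iterS.
rewrite [RHS]big_ord_recl /= bin0.
under [in RHS]eq_bigr => i _ do
  rewrite /bump /= binS PoszD mulrDr mulrzDr subSS.
rewrite big_split /= addrA [RHS]addrC; congr (_ + _).
pose F i := iter i f (iter (n.+1 - i) g v) *~ ((-1) ^+ (n.+1 - i) * 'C(n, i)%:Z).
transitivity (\sum_(i < n.+2) F i).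
  by rewrite [RHS]big_ord_recr /F /= (bin_small (ltnSn n)) mulr0 mulr0z addr0.
by rewrite [LHS]big_ord_recl /F /= bin0; congr (_ + _); apply: eq_bigr => i _.
Qed.

Hypotheses (p : nat) (p_pr : prime p) (Vp : forall v : V, v *+ p = 0).

Let Vpz n (v : V) : (p %| n)%N -> v *+ n = 0.
Proof. by case/dvdnP=> m ->; rewrite mulnC mulrnA Vp mul0rn. Qed.

Let signp (v : V) : v *~ (-1) ^+ p.-1 = v.
Proof.
have [p2|op] := even_prime p_pr; first last.
  by rewrite -signr_odd -[odd _]negbK -oddS prednK ?prime_gt0 // op mulr1z.
apply/eqP; rewrite p2 expr1 mulrN1z eq_sym -subr_eq0 opprK -mulr2n.
by rewrite -p2 Vp.
Qed.

Lemma iter_sub_prime v :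
  iter p (fun u => f u - g u) v = iter p f v - iter p g v.
Proof.
have p0 := prime_gt0 p_pr.
rewrite iter_sub big_ord_recr /= subnn binn mulr1z addrC; congr (_ + _).
case: p p_pr p0 Vpz signp => // q q_pr _ Vqz signq.
rewrite big_ord_recl /= bin0 subn0 mulr1 exprS mulN1r mulrNz signq.
rewrite big1 ?addr0 // => i _; rewrite /bump /= mulrC mulrzA.
by rewrite -pmulrn Vqz ?mul0rz // prime_dvd_bin //= ltnS ltn_ord.
Qed.

Lemma iter_sub_predp v :
  iter p.-1 (fun u => f u - g u) v =
  \sum_(i < p) iter i f (iter (p.-1 - i) g v).
Proof.
have bin_sign i (u : V) : (i < p)%N -> u *+ 'C(p.-1, i) = u *~ (-1) ^+ i.
  elim: i => [|i IHi] ip; first by rewrite bin0 mulr1z.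
  have := @Vpz 'C(p, i.+1) u; rewrite prime_dvd_bin // => /(_ isT).
  rewrite -{1}(prednK (prime_gt0 p_pr)) binS mulrnDr IHi 1?ltnW // => /eqP.
  by rewrite addr_eq0 => /eqP ->; rewrite exprS mulN1r mulrNz.
rewrite iter_sub prednK ?prime_gt0 //; apply: eq_bigr => i _.
rewrite mulrC mulrzA -pmulrn bin_sign // -mulrzA -exprD subnKC ?signp //.
by rewrite -ltnS prednK ?prime_gt0.
Qed.

End CommutingDifference.

Lemma iter_subf_prime (V : zmodType) (f g : V -> V) p :
    zmod_morphism f -> zmod_morphism g -> (forall v, f (g v) = g (f v)) ->
    prime p -> (forall v : V, v *+ p = 0) ->
  forall v, iter p (fun u => f u - g u) v = iter p f v - iter p g v.
Proof.
move=> fM gM fgC p_pr Vp v.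
pose F : {additive V -> V} := HB.pack f (GRing.isZmodMorphism.Build V V f fM).
pose G : {additive V -> V} := HB.pack g (GRing.isZmodMorphism.Build V V g gM).
exact: (@iter_sub_prime V F G fgC p p_pr Vp v).
Qed.

(* Jacobson's formula in an associative unital ring R of characteristic p,
   from the expansion of (x λ + y)^p in R[λ] and of its derivative. *)
Section JacobsonRing.
Variables (R : nzRingType) (p : nat) (p_pr : prime p).
Hypothesis Rp : forall r : R, r *+ p = 0.
Variables x y : R.

Let z : {poly R} := y%:P + x%:P * 'X.
Let ad (q : {poly R}) : {poly R} := z * q - q * z.

Let deriv_z : z^`() = x%:P.
Proof. by rewrite derivD derivC add0r derivM derivC mul0r add0r derivX mulr1. Qed.

Let deriv_zX n : (z ^+ n)^`() = \sum_(i < n) z ^+ i * (x%:P * z ^+ (n.-1 - i)).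
Proof.
elim: n => [|n IHn]; first by rewrite derivC big_ord0.
rewrite exprS derivM deriv_z IHn mulr_sumr big_ord_recl expr0 mul1r subn0 /=.
congr (_ + _); apply: eq_bigr => i _.
by rewrite /bump /= add1n mulrA -exprS; case: n i {IHn} => [[]//|n] i.
Qed.

Let coef_zX n : (z ^+ n)`_n = x ^+ n /\ forall m, (n < m)%N -> (z ^+ n)`_m = 0.
Proof.
elim: n => [|n [IHn IHn0]].
  by split=> [|m m0]; rewrite expr0 coefC //; case: m m0.
have cz m : (z ^+ n.+1)`_m.+1 = (z ^+ n)`_m.+1 * y + (z ^+ n)`_m * x.
  by rewrite exprSr mulrDr coefD coefMC mulrA coefMX /= coefMC.
split=> [|[//|m] nm]; first by rewrite cz IHn IHn0 // mul0r add0r -exprSr.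
by rewrite cz !IHn0 ?mul0r ?addr0 // ltnW.
Qed.

Let coef0_zX n : (z ^+ n)`_0 = y ^+ n.
Proof.
elim: n => [|n IHn]; first by rewrite !expr0 coefC.
by rewrite !exprSr mulrDr coefD coefMC mulrA coefMX /= addr0 IHn.
Qed.

Let sum_coef_zX n : (x + y) ^+ n = \sum_(i < n.+1) (z ^+ n)`_i.
Proof.
have -> : x + y = z.[1].
  by rewrite hornerD hornerC hornerMX hornerC mulr1 addrC.
rewrite -horner_exp_comm ?(@horner_coef_wide _ n.+1) //; last by rewrite /comm_poly mulr1 mul1r.
  by apply: eq_bigr => i _; rewrite expr1n mulr1.
apply/leq_sizeP => m; exact: (coef_zX n).2.
Qed.

Lemma jacobson_ring :
  exists c : nat -> R,
    (x + y) ^+ p = x ^+ p + y ^+ p + \sum_(1 <= i < p) c i /\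
    forall i, (0 < i)%N -> c i *+ i = (iter p.-1 ad x%:P)`_i.-1.
Proof.
have p0 := prime_gt0 p_pr.
exists (fun i => (z ^+ p)`_i); split.
  rewrite sum_coef_zX -(big_mkord xpredT (fun i => (z ^+ p)`_i)).
  rewrite big_nat_recr //= (coef_zX p).1 big_ltn // coef0_zX.
  by rewrite addrC addrA.
case=> // i _ /=; rewrite -coef_deriv deriv_zX.
have Pp (q : {poly R}) : q *+ p = 0 by apply/polyP => j; rewrite coefMn coef0 Rp.
have fgC q : (z \*o idfun) ((z \o* idfun) q) = (z \o* idfun) ((z \*o idfun) q).
  by rewrite /= mulrA.
have iterl n (q : {poly R}) : iter n (z \*o idfun) q = z ^+ n * q.
  by elim: n => [|n /= ->]; rewrite ?expr0 ?mul1r // exprS mulrA.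
have iterr n (q : {poly R}) : iter n (z \o* idfun) q = q * z ^+ n.
  by elim: n => [|n /= ->]; rewrite ?expr0 ?mulr1 // exprSr mulrA.
rewrite (iter_sub_predp fgC p_pr Pp).
by under [in RHS]eq_bigr => j _ do rewrite iterl iterr.
Qed.
End JacobsonRing.

(* Unitization k ⊕ A of the associative algebra (A, ⋆). *)
Definition dunital (k : fieldType) (A : dendType k) : Type := (k * A)%type.

Section Unitization.
Variables (k : fieldType) (A : dendType k).
Local Notation B := (dunital A).
HB.instance Definition _ := GRing.Zmodule.on B.
Let one : B := (1, 0).
Let mul (u v : B) : B := (u.1 * v.1, u.1 *: v.2 + v.1 *: u.2 + u.2 ⋆ v.2).

Let mulA : associative mul.
Proof.
case=> a u [b v] [c w]; rewrite /mul /= mulrA; congr (_, _).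
have sD (u1 u2 v1 : A) : (u1 + u2) ⋆ v1 = u1 ⋆ v1 + u2 ⋆ v1 by exact: linearDl.
have Ds (u1 v1 v2 : A) : u1 ⋆ (v1 + v2) = u1 ⋆ v1 + u1 ⋆ v2 by exact: linearDr.
have sZ d (u1 v1 : A) : (d *: u1) ⋆ v1 = d *: (u1 ⋆ v1) by exact: linearZl_LR.
have Zs d (u1 v1 : A) : u1 ⋆ (d *: v1) = d *: (u1 ⋆ v1) by exact: linearZr.
have := @dstarA k A; move: (@dstar k A) sD Ds sZ Zs => s sD Ds sZ Zs sA.
rewrite !sD !Ds !sZ !Zs !scalerDr !scalerA sA !addrA.
by rewrite [c * a]mulrC [c * b]mulrC [LHS](ACl (1*2*4*6*3*5*7))%AC.
Qed.
Let mul1 : left_id one mul.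
Proof. by case=> a u; rewrite /mul /= mul1r scale1r scaler0 linear0l !addr0. Qed.
Let mulr1' : right_id one mul.
Proof. by case=> a u; rewrite /mul /= mulr1 scale1r scaler0 linear0r addr0 add0r. Qed.
Let mulDl : left_distributive mul +%R.
Proof.
case=> a u [b v] [c w]; rewrite /mul /= mulrDl; congr (_, _).
have -> : (u + v) ⋆ w = u ⋆ w + v ⋆ w by exact: linearDl.
move: (@dstar k A) => s.
rewrite scalerDl scalerDr !addrA.
by rewrite [LHS](ACl (1*3*5*2*4*6))%AC.
Qed.
Let mulDr : right_distributive mul +%R.
Proof.
case=> a u [b v] [c w]; rewrite /mul /= mulrDr; congr (_, _).
have -> : u ⋆ (v + w) = u ⋆ v + u ⋆ w by exact: linearDr.
move: (@dstar k A) => s.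
rewrite scalerDl scalerDr !addrA.
by rewrite [LHS](ACl (1*3*5*2*4*6))%AC.
Qed.
Let one0 : one != 0.
Proof. by rewrite /one -pair_eqE /= oner_eq0. Qed.
HB.instance Definition _ :=
  GRing.Zmodule_isNzRing.Build B mulA mul1 mulr1' mulDl mulDr one0.

End Unitization.

(* The underlying space of A, seen as a restricted pre-Lie algebra. *)
Definition pPreLie_of (k : fieldType) (p : nat) (hp : p \in [pchar k])
  (A : dendType k) : Type := A.

Section PreLieOfDendriform.
Variables (k : fieldType) (p : nat) (hp : p \in [pchar k]) (A : dendType k).
Local Notation Ap := (pPreLie_of hp A).

HB.instance Definition _ := GRing.Lmodule.on Ap.

Let plm (x y : Ap) : Ap := (x : A) ≻ y - (y : A) ≺ x.

Let plm_bilinear : bilinear_for *:%R *:%R plm.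
Proof.
split=> u a v w; rewrite /plm.
  by rewrite linearPl linearPr /= scalerBr opprD addrACA.
by rewrite linearPl linearPr /= scalerBr opprD addrACA.
Qed.

Let plm_assoc (x y z : A) : plm x (plm y z) - plm (plm x y) z =
  ((x ≺ y) ≻ z + (y ≺ x) ≻ z) - (x ≻ (z ≺ y) + y ≻ (z ≺ x))
    + (z ≺ (y ≻ x) + z ≺ (x ≻ y)).
Proof.
have -> : plm x (plm y z) = x ≻ (y ≻ z) - x ≻ (z ≺ y) - ((y ≻ z) ≺ x - (z ≺ y) ≺ x).
  by rewrite /plm linearBr linearBl.
have -> : plm (plm x y) z = (x ≻ y) ≻ z - (y ≺ x) ≻ z - (z ≺ (x ≻ y) - z ≺ (y ≺ x)).
  by rewrite /plm linearBr linearBl.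
rewrite -dsuccA linearDl /= dprecA linearDr /= dsuccprecA.
rewrite !opprD !opprK !addrA [LHS](ACl (1*8*3*4*6*9*(2*7)*(5*10)))%AC /=.
by rewrite !subrr !addr0.
Qed.

Let plm_prelie x y z :
  plm x (plm y z) - plm (plm x y) z = plm y (plm x z) - plm (plm y x) z.
Proof.
by rewrite !plm_assoc; congr (_ - _ + _); rewrite addrC.
Qed.

HB.instance Definition _ := Lmodule_isPreLie.Build k Ap plm_bilinear plm_prelie.

Let plbrE (x y : Ap) : plbr x y = (x : A) ⋆ y - (y : A) ⋆ x.
Proof.
rewrite /plbr /plmul /= /plm /dstar opprB opprD !addrA.
by rewrite [LHS](ACl (3*1*2*4))%AC /= addrAC.
Qed.

Let p_pr : prime p. Proof. exact: pcharf_prime hp. Qed.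
Let p_gt0 : (0 < p)%N. Proof. exact: prime_gt0. Qed.

Let Ap0 (x : A) : x *+ p = 0.
Proof. by rewrite -scaler_nat (pcharf0 hp) scale0r. Qed.

Let pm (x : Ap) : Ap := dpow (x : A) p.

Let pmZ a x : pm (a *: x) = a ^+ p *: pm x.
Proof. exact: dpowZ. Qed.

Let pm_l x y : plmul (pm x) y = iter p (plmul x) y.
Proof.
have := @iter_subf_prime A (dsucc (x : A)) (fun v : A => v ≺ (x : A)) p.
move=> -> //.
- by rewrite /pm -dsucc_dpow // -dprec_dpow.
- by move=> u v; exact: linearBr.
- by move=> u v; exact: linearBl.
- by move=> v; rewrite dsuccprecA.
Qed.

Let iter_plbr (x y : Ap) : iter p (plbr x) y = plbr (pm x) y.
Proof.
have -> : plbr x = fun v : A => (x : A) ⋆ v - v ⋆ (x : A).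
  by apply/funext => v; rewrite plbrE.
have := @iter_subf_prime A (dstar (x : A)) (fun v : A => v ⋆ (x : A)) p.
move=> -> //.
- by rewrite plbrE /pm -dstar_dpowl // -dstar_dpowr.
- by move=> u v; exact: linearBr.
- by move=> u v; exact: linearBl.
- by move=> v; rewrite dstarA.
Qed.

Let pm_r x y : plmul y (pm x) = iter p (plmul x) y - iter p (plbr x) y.
Proof. by rewrite iter_plbr -pm_l /plbr opprB addrC subrK. Qed.

Local Notation B := (dunital A).

Let Bp (b : B) : b *+ p = 0.
Proof.
apply/eqP; rewrite -pair_eqE; apply/andP; split; apply/eqP.
  by rewrite (raddfMn fst) -mulr_natr (pcharf0 hp) mulr0.
by rewrite (raddfMn snd) Ap0.
Qed.

Let emb (a : A) : B := (0, a).

Let mul_emb a b : emb a * emb b = emb (a ⋆ b).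
Proof. by congr (_, _); rewrite /= ?mul0r // !scale0r !add0r. Qed.

Let exp_emb a n : emb a ^+ n.+1 = emb (dpow a n.+1).
Proof. by elim: n => [|n IHn]; rewrite ?expr1 // exprS IHn mul_emb. Qed.

Let emb_coef (Q : {poly B}) (f : nat -> Ap) := forall n, Q`_n = emb (f n).

Let emb_br (Q1 Q2 : {poly B}) f1 f2 : emb_coef Q1 f1 -> emb_coef Q2 f2 ->
  emb_coef (Q1 * Q2 - Q2 * Q1) (lam_br f1 f2).
Proof.
move=> E1 E2 n; rewrite coefB coefM coefMr -sumrB /lam_br.
have embD : {morph emb : u v / u + v} by move=> u v; congr (_, _); rewrite addr0.
rewrite (big_morph _ embD (erefl _)); apply: eq_bigr => i _.
rewrite E1 E2 !mul_emb plbrE.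
by congr (_, _); rewrite /= subr0.
Qed.

Let pmD x y :
  pm (x + y) = pm x + pm y + \sum_(1 <= i < p) jacobson_s p i x y.
Proof.
have [c [cE cs]] := jacobson_ring p_pr Bp (emb x) (emb y).
have := congr1 snd cE.
have -> : emb x + emb y = emb (x + y) by congr (_, _); rewrite /= addr0.
rewrite -{1 2 3}(prednK p_gt0) !exp_emb prednK // (raddfD snd) (raddfD snd) /=.
rewrite (raddf_sum snd) /= /pm => ->; congr (_ + _).
rewrite big_nat [RHS]big_nat; apply: eq_bigr => i /andP[i_gt0 ltip].
rewrite /jacobson_s.
set F := iter _ _ _.
have E : emb_coef (iter p.-1 (fun q => ((emb y)%:P + (emb x)%:P * 'X) * q
             - q * ((emb y)%:P + (emb x)%:P * 'X)) (emb x)%:P) F.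
  rewrite /F; elim: p.-1 => [|n IHn] /=.
    by case=> [|m]; rewrite coefC.
  apply: emb_br IHn => -[|[|m]]; rewrite coefD coefC coefMX /= ?addr0 ?coefC ?add0r //.
have := congr1 snd (cs i i_gt0); rewrite E (raddfMn snd) /= => <-.
rewrite -scaler_nat scalerK //.
have := dvdn_pcharf hp i => <-; by rewrite gtnNdvd.
Qed.

HB.instance Definition _ :=
  PreLie_isRestricted.Build k p Ap pmZ pm_l pm_r pmD.

End PreLieOfDendriform.

Record dend_hom (k : fieldType) (A B : dendType k) := DendHom {
  dend_fun :> A -> B;
  dend_fun_linear : linear dend_fun;
  dend_fun_prec : {morph dend_fun : x y / x ≺ y};
  dend_fun_succ : {morph dend_fun : x y / x ≻ y}
}.

Record rprelie_hom (k : fieldType) (p : nat) (P Q : rPreLieType k p) :=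
  RPreLieHom {
  rprelie_fun :> P -> Q;
  rprelie_fun_linear : linear rprelie_fun;
  rprelie_fun_mul : {morph rprelie_fun : x y / plmul x y};
  rprelie_fun_pmap : {morph rprelie_fun : x / p_map x}
}.

Lemma dend_hom_eq (k : fieldType) (A B : dendType k) (f g : dend_hom A B) :
  f =1 g -> f = g.
Proof.
case: f g => [f f1 f2 f3] [g g1 g2 g3] /= /funext fg.
by subst g; congr DendHom; exact: Prop_irrelevance.
Qed.

Lemma rprelie_hom_eq (k : fieldType) (p : nat) (P Q : rPreLieType k p)
  (f g : rprelie_hom P Q) : f =1 g -> f = g.
Proof.
case: f g => [f f1 f2 f3] [g g1 g2 g3] /= /funext fg.
by subst g; congr RPreLieHom; exact: Prop_irrelevance.
Qed.

Lemma dend_hom_star (k : fieldType) (A B : dendType k) (f : dend_hom A B) :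
  {morph f : x y / x ⋆ y}.
Proof.
move=> x y; rewrite /dstar -dend_fun_prec -dend_fun_succ.
by have := dend_fun_linear f 1 (x ≺ y) (x ≻ y); rewrite !scale1r.
Qed.

Lemma dend_hom_dpow (k : fieldType) (A B : dendType k) (f : dend_hom A B) n :
  {morph f : x / dpow x n}.
Proof.
move=> x; rewrite /dpow; elim: n.-1 => //= m IHm.
by rewrite dend_hom_star IHm.
Qed.

Lemma linear_sub (k : fieldType) (V W : lmodType k) (f : V -> W) :
  linear f -> {morph f : x y / x - y}.
Proof.
move=> fl x y.
by rewrite addrC -scaleN1r fl scaleN1r addrC.
Qed.

Section FreeDendriform.
Variables (k : fieldType) (V : lmodType k).

(* Dend(V) is presented by generators and relations: dendriform expressions
   in the elements of V, modulo the least congruence that imposes the axioms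
   of vector spaces, bilinearity, the dendriform axioms and the linear
   relations between the elements of V. *)
Inductive dterm : Type :=
| Tgen of V
| Tzero
| Tadd of dterm & dterm
| Tscale of k & dterm
| Tprec of dterm & dterm
| Tsucc of dterm & dterm.

Inductive dcong : dterm -> dterm -> Prop :=
| dc_refl t : dcong t t
| dc_sym t u : dcong t u -> dcong u t
| dc_trans t u v : dcong t u -> dcong u v -> dcong t v
| dc_add t t' u u' :
    dcong t t' -> dcong u u' -> dcong (Tadd t u) (Tadd t' u')
| dc_scale a t t' : dcong t t' -> dcong (Tscale a t) (Tscale a t')
| dc_prec t t' u u' :
    dcong t t' -> dcong u u' -> dcong (Tprec t u) (Tprec t' u')
| dc_succ t t' u u' :
    dcong t t' -> dcong u u' -> dcong (Tsucc t u) (Tsucc t' u')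
| dc_addA t u v : dcong (Tadd t (Tadd u v)) (Tadd (Tadd t u) v)
| dc_addC t u : dcong (Tadd t u) (Tadd u t)
| dc_add0 t : dcong (Tadd Tzero t) t
| dc_addN t : dcong (Tadd (Tscale (- 1) t) t) Tzero
| dc_scaleA a b t : dcong (Tscale a (Tscale b t)) (Tscale (a * b) t)
| dc_scale1 t : dcong (Tscale 1 t) t
| dc_scaleDr a t u :
    dcong (Tscale a (Tadd t u)) (Tadd (Tscale a t) (Tscale a u))
| dc_scaleDl a b t :
    dcong (Tscale (a + b) t) (Tadd (Tscale a t) (Tscale b t))
| dc_precPl a t u v :
    dcong (Tprec (Tadd (Tscale a t) u) v)
          (Tadd (Tscale a (Tprec t v)) (Tprec u v))
| dc_precPr a t u v :
    dcong (Tprec v (Tadd (Tscale a t) u))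
          (Tadd (Tscale a (Tprec v t)) (Tprec v u))
| dc_succPl a t u v :
    dcong (Tsucc (Tadd (Tscale a t) u) v)
          (Tadd (Tscale a (Tsucc t v)) (Tsucc u v))
| dc_succPr a t u v :
    dcong (Tsucc v (Tadd (Tscale a t) u))
          (Tadd (Tscale a (Tsucc v t)) (Tsucc v u))
| dc_precA t u v :
    dcong (Tprec (Tprec t u) v) (Tprec t (Tadd (Tprec u v) (Tsucc u v)))
| dc_succprecA t u v :
    dcong (Tprec (Tsucc t u) v) (Tsucc t (Tprec u v))
| dc_succA t u v :
    dcong (Tsucc (Tadd (Tprec t u) (Tsucc t u)) v) (Tsucc t (Tsucc u v))
| dc_gen a x y :
    dcong (Tgen (a *: x + y)) (Tadd (Tscale a (Tgen x)) (Tgen y)).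

HB.instance Definition _ := gen_eqMixin dterm.
HB.instance Definition _ := gen_choiceMixin dterm.

Definition dcongb (t u : dterm) : bool := `[< dcong t u >].

Lemma dcongb_equiv : equiv_class_of dcongb.
Proof.
split=> [t|t u|u t v].
- exact/asboolP/dc_refl.
- by apply/asboolP/asboolP; exact: dc_sym.
- by move=> /asboolP tu /asboolP uv; apply/asboolP/(dc_trans tu).
Qed.
Canonical dcongb_equivRel := EquivRelPack dcongb_equiv.

Definition free_dend : Type := {eq_quot dcongb}.
HB.instance Definition _ := Choice.on free_dend.

Let pi (t : dterm) : free_dend := \pi_({eq_quot dcongb}) t.

Lemma free_dend_piP t u : reflect (dcong t u) (pi t == pi u).
Proof. by apply: (iffP eqP) => [/eqmodP/asboolP|?]; last exact/eqmodP/asboolP. Qed.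

Let piE t u : dcong t u -> pi t = pi u.
Proof. by move/free_dend_piP/eqP. Qed.

Let rp (x : free_dend) : dterm := repr (x : {eq_quot dcongb}).
Let rpK x : pi (rp x) = x. Proof. exact: reprK. Qed.
Let rp_pi t : dcong (rp (pi t)) t. Proof. by apply/free_dend_piP; rewrite rpK. Qed.

Let fzero := pi Tzero.
Let fadd x y := pi (Tadd (rp x) (rp y)).
Let fscale a x := pi (Tscale a (rp x)).
Let fopp := fscale (- 1).
Let fprec x y := pi (Tprec (rp x) (rp y)).
Let fsucc x y := pi (Tsucc (rp x) (rp y)).

Let pi_add t u : fadd (pi t) (pi u) = pi (Tadd t u).
Proof. by apply/piE/dc_add. Qed.
Let pi_scale a t : fscale a (pi t) = pi (Tscale a t).
Proof. by apply/piE/dc_scale. Qed.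
Let pi_prec t u : fprec (pi t) (pi u) = pi (Tprec t u).
Proof. by apply/piE/dc_prec. Qed.
Let pi_succ t u : fsucc (pi t) (pi u) = pi (Tsucc t u).
Proof. by apply/piE/dc_succ. Qed.
Let pi_opp t : fopp (pi t) = pi (Tscale (- 1) t). Proof. exact: pi_scale. Qed.
Let pis := (pi_add, pi_opp, pi_scale, pi_prec, pi_succ).

Let faddA : associative fadd.
Proof. move=> x y z; rewrite -[x]rpK -[y]rpK -[z]rpK !pis; exact/piE/dc_addA. Qed.
Let faddC : commutative fadd.
Proof. move=> x y; rewrite -[x]rpK -[y]rpK !pis; exact/piE/dc_addC. Qed.
Let fadd0 : left_id fzero fadd.
Proof. move=> x; rewrite -[x]rpK !pis; exact/piE/dc_add0. Qed.
Let faddN : left_inverse fzero fopp fadd.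
Proof. move=> x; rewrite -[x]rpK !pis; exact/piE/dc_addN. Qed.
HB.instance Definition _ := GRing.isZmodule.Build free_dend faddA faddC fadd0 faddN.

Let fscaleA a b x : fscale a (fscale b x) = fscale (a * b) x.
Proof. rewrite -[x]rpK !pis; exact/piE/dc_scaleA. Qed.
Let fscale1 : left_id 1 fscale.
Proof. move=> x; rewrite -[x]rpK !pis; exact/piE/dc_scale1. Qed.
Let fscaleDr : right_distributive fscale +%R.
Proof.
move=> a x y; rewrite -[x]rpK -[y]rpK /GRing.add /= !pis; exact/piE/dc_scaleDr.
Qed.
Let fscaleDl x : {morph fscale^~ x : a b / a + b}.
Proof.
move=> a b; rewrite -[x]rpK !pis [RHS]pi_add; exact/piE/dc_scaleDl.
Qed.
HB.instance Definition _ := GRing.Zmodule_isLmodule.Build k free_dend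
  fscaleA fscale1 fscaleDr fscaleDl.

Let faddE (x y : free_dend) : x + y = fadd x y. Proof. by []. Qed.
Let fscaleE a (x : free_dend) : a *: x = fscale a x. Proof. by []. Qed.
Let opE := (faddE, fscaleE).

Let fprec_bilinear : bilinear_for *:%R *:%R fprec.
Proof.
split=> v a t u; rewrite /= !opE -[v]rpK -[t]rpK -[u]rpK !pis.
  exact/piE/dc_precPl.
exact/piE/dc_precPr.
Qed.
Let fsucc_bilinear : bilinear_for *:%R *:%R fsucc.
Proof.
split=> v a t u; rewrite /= !opE -[v]rpK -[t]rpK -[u]rpK !pis.
  exact/piE/dc_succPl.
exact/piE/dc_succPr.
Qed.
Let fprecA x y z : fprec (fprec x y) z = fprec x (fprec y z + fsucc y z).
Proof.
rewrite -[x]rpK -[y]rpK -[z]rpK !opE !pis; exact/piE/dc_precA.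
Qed.
Let fsuccprecA x y z : fprec (fsucc x y) z = fsucc x (fprec y z).
Proof.
rewrite -[x]rpK -[y]rpK -[z]rpK !pis; exact/piE/dc_succprecA.
Qed.
Let fsuccA x y z : fsucc (fprec x y + fsucc x y) z = fsucc x (fsucc y z).
Proof.
rewrite -[x]rpK -[y]rpK -[z]rpK !opE !pis; exact/piE/dc_succA.
Qed.
HB.instance Definition _ := Lmodule_isDendriform.Build k free_dend
  fprec_bilinear fsucc_bilinear fprecA fsuccprecA fsuccA.

Definition dgen (x : V) : free_dend := pi (Tgen x).

Lemma dgen_linear : linear dgen.
Proof.
move=> a x y; rewrite !opE /dgen !pis; exact/piE/dc_gen.
Qed.

Section Lift.
Variables (A : dendType k) (f : V -> A).

Fixpoint deval (t : dterm) : A :=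
  match t with
  | Tgen v => f v
  | Tzero => 0
  | Tadd t u => deval t + deval u
  | Tscale a t => a *: deval t
  | Tprec t u => deval t ≺ deval u
  | Tsucc t u => deval t ≻ deval u
  end.

Hypothesis f_linear : linear f.

Lemma deval_cong t u : dcong t u -> deval t = deval u.
Proof.
elim=> //=.
- by move=> t1 u1 v1 _ -> _ ->.
- by move=> t1 t2 u1 u2 _ -> _ ->.
- by move=> a t1 t2 _ ->.
- by move=> t1 t2 u1 u2 _ -> _ ->.
- by move=> t1 t2 u1 u2 _ -> _ ->.
- by move=> *; rewrite addrA.
- by move=> *; rewrite addrC.
- by move=> *; rewrite add0r.
- by move=> *; rewrite scaleN1r addNr.
- by move=> *; rewrite scalerA.
- by move=> *; rewrite scale1r.
- by move=> *; rewrite scalerDr.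
- by move=> *; rewrite scalerDl.
- by move=> *; rewrite linearPl.
- by move=> *; rewrite linearPr.
- by move=> *; rewrite linearPl.
- by move=> *; rewrite linearPr.
- by move=> *; rewrite dprecA.
- by move=> *; rewrite dsuccprecA.
- by move=> *; rewrite dsuccA.
Qed.

Definition dlift_fun (x : free_dend) : A := deval (rp x).

Let dlift_pi t : dlift_fun (pi t) = deval t.
Proof. exact/deval_cong/rp_pi. Qed.

Lemma dlift_linear : linear dlift_fun.
Proof. by move=> a x y; rewrite -[x]rpK -[y]rpK !opE !pis !dlift_pi. Qed.
Lemma dlift_prec : {morph dlift_fun : x y / x ≺ y}.
Proof. by move=> x y; rewrite -[x]rpK -[y]rpK [_ ≺ _]pi_prec !dlift_pi. Qed.
Lemma dlift_succ : {morph dlift_fun : x y / x ≻ y}.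
Proof. by move=> x y; rewrite -[x]rpK -[y]rpK [_ ≻ _]pi_succ !dlift_pi. Qed.

Definition dlift : dend_hom free_dend A :=
  DendHom dlift_linear dlift_prec dlift_succ.

Lemma dlift_gen x : dlift (dgen x) = f x.
Proof. exact: dlift_pi. Qed.

Lemma dlift_unique (g : dend_hom free_dend A) :
  (forall x, g (dgen x) = f x) -> g = dlift.
Proof.
move=> gE; apply: dend_hom_eq => x; rewrite -[x]rpK /= dlift_pi.
have gl := dend_fun_linear g.
have g0 : g 0 = 0 by have := linear_sub gl 0 0; rewrite !subrr.
elim: (rp x) => [v||t IHt u IHu|a t IHt|t IHt u IHu|t IHt u IHu] /=.
- exact: gE.
- exact: g0.
- rewrite -pi_add -IHt -IHu -[LHS]/(g (_ + _)) -{1}[pi t]scale1r.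
  by rewrite gl scale1r.
- by rewrite -pi_scale -IHt -[LHS]/(g (_ *: _)) -[_ *: pi t]addr0 gl g0 addr0.
- by rewrite -pi_prec -IHt -IHu; exact: dend_fun_prec.
- by rewrite -pi_succ -IHt -IHu; exact: dend_fun_succ.
Qed.

End Lift.
End FreeDendriform.

Record dendIdeal (k : fieldType) (D : dendType k) := DendIdeal {
  ideal_pred :> {pred D};
  ideal_submod : submod_closed ideal_pred;
  ideal_precl : forall x y, x \in ideal_pred -> x ≺ y \in ideal_pred;
  ideal_precr : forall x y, y \in ideal_pred -> x ≺ y \in ideal_pred;
  ideal_succl : forall x y, x \in ideal_pred -> x ≻ y \in ideal_pred;
  ideal_succr : forall x y, y \in ideal_pred -> x ≻ y \in ideal_pred
}.

HB.instance Definition _ (k : fieldType) (D : dendType k) (I : dendIdeal D) :=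
  GRing.isZmodClosed.Build D (ideal_pred I)
    (GRing.submod_closedB (ideal_submod I)).
HB.instance Definition _ (k : fieldType) (D : dendType k) (I : dendIdeal D) :=
  GRing.isScaleClosed.Build k D (ideal_pred I)
    (GRing.subsemimod_closedZ (GRing.submod_closed_semi (ideal_submod I))).

Section GeneratedIdeal.
Variables (k : fieldType) (D : dendType k) (G : D -> Prop).

Definition gen_pred : {pred D} :=
  [pred x | `[< forall I : dendIdeal D,
                  (forall y, G y -> y \in I) -> x \in I >]].

Let gen_predP x :
  x \in gen_pred <->
  forall I : dendIdeal D, (forall y, G y -> y \in I) -> x \in I.
Proof. by rewrite inE; split=> /asboolP. Qed.

Let gen_submod : submod_closed gen_pred.
Proof.
split=> [|a x y /gen_predP xI /gen_predP yI]; apply/gen_predP => I GI.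
  exact: rpred0.
by rewrite rpredD ?rpredZ ?xI ?yI.
Qed.

Let gen_precl x y : x \in gen_pred -> x ≺ y \in gen_pred.
Proof.
by move=> /gen_predP xI; apply/gen_predP => I GI; rewrite ideal_precl ?xI.
Qed.
Let gen_precr x y : y \in gen_pred -> x ≺ y \in gen_pred.
Proof.
by move=> /gen_predP yI; apply/gen_predP => I GI; rewrite ideal_precr ?yI.
Qed.
Let gen_succl x y : x \in gen_pred -> x ≻ y \in gen_pred.
Proof.
by move=> /gen_predP xI; apply/gen_predP => I GI; rewrite ideal_succl ?xI.
Qed.
Let gen_succr x y : y \in gen_pred -> x ≻ y \in gen_pred.
Proof.
by move=> /gen_predP yI; apply/gen_predP => I GI; rewrite ideal_succr ?yI.
Qed.
Definition ideal_gen : dendIdeal D := DendIdeal gen_submod gen_precl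
  gen_precr gen_succl gen_succr.

Lemma ideal_genP x :
  x \in ideal_gen <->
  forall I : dendIdeal D, (forall y, G y -> y \in I) -> x \in I.
Proof. exact: gen_predP. Qed.

Lemma mem_ideal_gen x : G x -> x \in ideal_gen.
Proof. by move=> Gx; apply/ideal_genP => I; exact. Qed.
End GeneratedIdeal.

Section Quotient.
Variables (k : fieldType) (D : dendType k) (I : dendIdeal D).

Definition dend_quot : Type := Quotient.quot I.
HB.instance Definition _ := GRing.Zmodule.on dend_quot.

Definition qproj (x : D) : dend_quot := \pi_(Quotient.quot I) x.
Definition qrepr (x : dend_quot) : D := repr (x : Quotient.quot I).

Lemma qreprK x : qproj (qrepr x) = x. Proof. exact: reprK. Qed.

Lemma qprojP x y : qproj x = qproj y <-> x - y \in I.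
Proof. by rewrite Quotient.idealrBE; split=> /eqP. Qed.

Lemma qproj0 : qproj 0 = 0.
Proof. by rewrite /qproj raddf0. Qed.

Lemma qproj_eq0 x : qproj x = 0 <-> x \in I.
Proof. by rewrite -qproj0 qprojP subr0. Qed.

Let qprojB x : qrepr (qproj x) - x \in I.
Proof. by apply/qprojP; rewrite qreprK. Qed.

Lemma qprojD : {morph qproj : x y / x + y}.
Proof. by move=> x y; rewrite /qproj raddfD. Qed.

Let qscale (a : k) (x : dend_quot) : dend_quot := qproj (a *: qrepr x).
Let qprec (x y : dend_quot) : dend_quot := qproj (qrepr x ≺ qrepr y).
Let qsucc (x y : dend_quot) : dend_quot := qproj (qrepr x ≻ qrepr y).

Let qprojZ a x : qscale a (qproj x) = qproj (a *: x).
Proof. by apply/qprojP; rewrite -scalerBr rpredZ ?qprojB. Qed.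

Let qproj_prec x y : qprec (qproj x) (qproj y) = qproj (x ≺ y).
Proof.
apply/qprojP; set x' := qrepr _; set y' := qrepr _.
have -> : x' ≺ y' - x ≺ y = (x' - x) ≺ y' + x ≺ (y' - y).
  by rewrite linearBl linearBr /= addrA subrK.
by apply: rpredD; [apply/ideal_precl/qprojB | apply/ideal_precr/qprojB].
Qed.
Let qproj_succ x y : qsucc (qproj x) (qproj y) = qproj (x ≻ y).
Proof.
apply/qprojP; set x' := qrepr _; set y' := qrepr _.
have -> : x' ≻ y' - x ≻ y = (x' - x) ≻ y' + x ≻ (y' - y).
  by rewrite linearBl linearBr /= addrA subrK.
by apply: rpredD; [apply/ideal_succl/qprojB | apply/ideal_succr/qprojB].
Qed.

Let qscaleA a b x : qscale a (qscale b x) = qscale (a * b) x.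
Proof. by rewrite -[x]qreprK !qprojZ scalerA. Qed.
Let qscale1 : left_id 1 qscale.
Proof. by move=> x; rewrite -[x]qreprK !qprojZ scale1r. Qed.
Let qscaleDr : right_distributive qscale +%R.
Proof.
by move=> a x y; rewrite -[x]qreprK -[y]qreprK -qprojD !qprojZ scalerDr qprojD.
Qed.
Let qscaleDl x : {morph qscale^~ x : a b / a + b}.
Proof. by move=> a b; rewrite -[x]qreprK !qprojZ scalerDl qprojD. Qed.
HB.instance Definition _ := GRing.Zmodule_isLmodule.Build k dend_quot
  qscaleA qscale1 qscaleDr qscaleDl.

Lemma qproj_linear : linear qproj.
Proof. by move=> a x y; rewrite qprojD -qprojZ. Qed.

Let qprec_bilinear : bilinear_for *:%R *:%R qprec.
Proof.
split=> z a x y; rewrite /= -[x]qreprK -[y]qreprK -[z]qreprK -qproj_linear.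
  by rewrite !qproj_prec -qproj_linear linearPl.
by rewrite !qproj_prec -qproj_linear linearPr.
Qed.
Let qsucc_bilinear : bilinear_for *:%R *:%R qsucc.
Proof.
split=> z a x y; rewrite /= -[x]qreprK -[y]qreprK -[z]qreprK -qproj_linear.
  by rewrite !qproj_succ -qproj_linear linearPl.
by rewrite !qproj_succ -qproj_linear linearPr.
Qed.
Let qprecA x y z : qprec (qprec x y) z = qprec x (qprec y z + qsucc y z).
Proof.
rewrite -[x]qreprK -[y]qreprK -[z]qreprK !qproj_prec qproj_succ -qprojD.
by rewrite qproj_prec dprecA.
Qed.
Let qsuccprecA x y z : qprec (qsucc x y) z = qsucc x (qprec y z).
Proof.
rewrite -[x]qreprK -[y]qreprK -[z]qreprK !(qproj_prec, qproj_succ).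
by rewrite dsuccprecA.
Qed.
Let qsuccA x y z : qsucc (qprec x y + qsucc x y) z = qsucc x (qsucc y z).
Proof.
rewrite -[x]qreprK -[y]qreprK -[z]qreprK qproj_prec !qproj_succ -qprojD.
by rewrite qproj_succ dsuccA.
Qed.
HB.instance Definition _ := Lmodule_isDendriform.Build k dend_quot
  qprec_bilinear qsucc_bilinear qprecA qsuccprecA qsuccA.

Lemma qprojM_prec : {morph qproj : x y / x ≺ y}.
Proof. by move=> x y; rewrite -qproj_prec. Qed.
Lemma qprojM_succ : {morph qproj : x y / x ≻ y}.
Proof. by move=> x y; rewrite -qproj_succ. Qed.
Definition qproj_hom : dend_hom D dend_quot :=
  DendHom qproj_linear qprojM_prec qprojM_succ.

Section QLift.
Variables (A : dendType k) (f : dend_hom D A).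
Hypothesis fI : forall x, x \in I -> f x = 0.

Definition qlift_fun (x : dend_quot) : A := f (qrepr x).

Let qlift_proj x : qlift_fun (qproj x) = f x.
Proof.
apply/eqP; rewrite -subr_eq0 -(linear_sub (dend_fun_linear f)).
by apply/eqP/fI.
Qed.

Lemma qlift_linear : linear qlift_fun.
Proof.
move=> a x y; rewrite -[x]qreprK -[y]qreprK -qproj_linear !qlift_proj.
exact: dend_fun_linear.
Qed.
Lemma qlift_prec : {morph qlift_fun : x y / x ≺ y}.
Proof.
move=> x y; rewrite -[x]qreprK -[y]qreprK -qprojM_prec !qlift_proj.
exact: dend_fun_prec.
Qed.
Lemma qlift_succ : {morph qlift_fun : x y / x ≻ y}.
Proof.
move=> x y; rewrite -[x]qreprK -[y]qreprK -qprojM_succ !qlift_proj.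
exact: dend_fun_succ.
Qed.
Definition qlift : dend_hom dend_quot A := DendHom qlift_linear qlift_prec qlift_succ.

Lemma qliftE x : qlift (qproj x) = f x. Proof. exact: qlift_proj. Qed.
End QLift.

End Quotient.

Section KernelIdeal.
Variables (k : fieldType) (D A : dendType k) (f : dend_hom D A).

Definition ker_pred : {pred D} := [pred x | f x == 0].

Let ker_submod : submod_closed ker_pred.
Proof.
have f0 : f 0 = 0 by have := linear_sub (dend_fun_linear f) 0 0; rewrite !subrr.
split=> [|a x y]; rewrite !inE ?f0 // => /eqP fx /eqP fy.
by rewrite dend_fun_linear fx fy scaler0 addr0.
Qed.

Let ker_precl x y : x \in ker_pred -> x ≺ y \in ker_pred.
Proof. by rewrite !inE dend_fun_prec => /eqP->; rewrite linear0l. Qed.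
Let ker_precr x y : y \in ker_pred -> x ≺ y \in ker_pred.
Proof. by rewrite !inE dend_fun_prec => /eqP->; rewrite linear0r. Qed.
Let ker_succl x y : x \in ker_pred -> x ≻ y \in ker_pred.
Proof. by rewrite !inE dend_fun_succ => /eqP->; rewrite linear0l. Qed.
Let ker_succr x y : y \in ker_pred -> x ≻ y \in ker_pred.
Proof. by rewrite !inE dend_fun_succ => /eqP->; rewrite linear0r. Qed.
Definition dker : dendIdeal D := DendIdeal ker_submod ker_precl
  ker_precr ker_succl ker_succr.

Lemma ideal_gen_ker (G : D -> Prop) :
  (forall x, G x -> f x = 0) -> forall x, x \in ideal_gen G -> f x = 0.
Proof.
move=> Gf x /ideal_genP/(_ dker) xI.
by apply/eqP/xI => y /Gf fy; rewrite inE fy.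
Qed.
End KernelIdeal.

Record category := Category {
  obj :> Type;
  hom : obj -> obj -> Type;
  idm : forall a, hom a a;
  mcomp : forall a b c, hom b c -> hom a b -> hom a c;
  compA : forall a b c d (h : hom c d) (g : hom b c) (f : hom a b),
    mcomp h (mcomp g f) = mcomp (mcomp h g) f;
  comp1m : forall a b (f : hom a b), mcomp (idm b) f = f;
  compm1 : forall a b (f : hom a b), mcomp f (idm a) = f
}.
Arguments idm {_} _.

Declare Scope cat_scope.
Delimit Scope cat_scope with cat.
Notation "g ∘ f" := (mcomp g f) (at level 40, left associativity) : cat_scope.
Local Open Scope cat_scope.

Record functor (C D : category) := Functor {
  fobj :> C -> D;
  fmap : forall a b : C, hom a b -> hom (fobj a) (fobj b);
  fmap1 : forall a, fmap (idm a) = idm (fobj a);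
  fmap_comp : forall (a b c : C) (g : hom b c) (f : hom a b),
    fmap (g ∘ f) = fmap g ∘ fmap f
}.

(* Stated by a unit and a counit satisfying the triangle identities. *)
Definition left_adjoint (C D : category) (F : functor C D) (G : functor D C) :=
  exists (eta : forall c : C, hom c (G (F c)))
         (eps : forall d : D, hom (F (G d)) d),
  [/\ forall (c c' : C) (f : hom c c'),
        fmap G (fmap F f) ∘ eta c = eta c' ∘ f,
      forall (d d' : D) (g : hom d d'),
        g ∘ eps d = eps d' ∘ fmap F (fmap G g),
      forall c : C, eps (F c) ∘ fmap F (eta c) = idm (F c)
    & forall d : D, fmap G (eps d) ∘ eta (G d) = idm (G d)].

Definition natural_hom_bijection
    (C D : category) (F : functor C D) (G : functor D C)
    (Phi : forall (c : C) (d : D), hom c (G d) -> hom (F c) d) :=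
  [/\ forall c d, bijective (Phi c d),
      forall (c c' : C) (d : D) (f : hom c' c) (u : hom c (G d)),
        Phi c' d (u ∘ f) = Phi c d u ∘ fmap F f
    & forall (c : C) (d d' : D) (g : hom d d') (u : hom c (G d)),
        Phi c d' (fmap G g ∘ u) = g ∘ Phi c d u].

Lemma linear_comp (k : fieldType) (U V W : lmodType k) (g : V -> W) (f : U -> V) :
  linear g -> linear f -> linear (g \o f).
Proof. by move=> gl fl a x y; rewrite /= fl gl. Qed.

Section DendCategory.
Variable k : fieldType.

Definition dend_id (A : dendType k) : dend_hom A A :=
  @DendHom k A A id (fun _ _ _ => erefl) (fun _ _ => erefl) (fun _ _ => erefl).

Section Comp.
Variables (A B C : dendType k) (g : dend_hom B C) (f : dend_hom A B).
Let comp_prec : {morph g \o f : x y / x ≺ y}.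
Proof. by move=> x y; rewrite /= !dend_fun_prec. Qed.
Let comp_succ : {morph g \o f : x y / x ≻ y}.
Proof. by move=> x y; rewrite /= !dend_fun_succ. Qed.
Definition dend_comp : dend_hom A C :=
  DendHom (linear_comp (dend_fun_linear g) (dend_fun_linear f))
    comp_prec comp_succ.
End Comp.

Let dend_compA (A B C D : dendType k) (h : dend_hom C D) (g : dend_hom B C)
  (f : dend_hom A B) :
  dend_comp h (dend_comp g f) = dend_comp (dend_comp h g) f.
Proof. exact: dend_hom_eq. Qed.
Let dend_comp1m (A B : dendType k) (f : dend_hom A B) :
  dend_comp (dend_id B) f = f.
Proof. exact: dend_hom_eq. Qed.
Let dend_compm1 (A B : dendType k) (f : dend_hom A B) :
  dend_comp f (dend_id A) = f.
Proof. exact: dend_hom_eq. Qed.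

Definition dend_cat : category := Category dend_compA dend_comp1m dend_compm1.
End DendCategory.

Section RPreLieCategory.
Variables (k : fieldType) (p : nat).

Definition rprelie_id (P : rPreLieType k p) : rprelie_hom P P :=
  @RPreLieHom k p P P id
    (fun _ _ _ => erefl) (fun _ _ => erefl) (fun _ => erefl).

Section Comp.
Variables (P Q R : rPreLieType k p) (g : rprelie_hom Q R) (f : rprelie_hom P Q).
Let comp_mul : {morph g \o f : x y / plmul x y}.
Proof. by move=> x y; rewrite /= !rprelie_fun_mul. Qed.
Let comp_pmap : {morph g \o f : x / p_map x}.
Proof. by move=> x; rewrite /= !rprelie_fun_pmap. Qed.
Definition rprelie_comp : rprelie_hom P R :=
  RPreLieHom (linear_comp (rprelie_fun_linear g) (rprelie_fun_linear f))
    comp_mul comp_pmap.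
End Comp.

Let rprelie_compA (P Q R S : rPreLieType k p) (h : rprelie_hom R S)
  (g : rprelie_hom Q R) (f : rprelie_hom P Q) :
  rprelie_comp h (rprelie_comp g f) = rprelie_comp (rprelie_comp h g) f.
Proof. exact: rprelie_hom_eq. Qed.
Let rprelie_comp1m (P Q : rPreLieType k p) (f : rprelie_hom P Q) :
  rprelie_comp (rprelie_id Q) f = f.
Proof. exact: rprelie_hom_eq. Qed.
Let rprelie_compm1 (P Q : rPreLieType k p) (f : rprelie_hom P Q) :
  rprelie_comp f (rprelie_id P) = f.
Proof. exact: rprelie_hom_eq. Qed.

Definition rprelie_cat : category :=
  Category rprelie_compA rprelie_comp1m rprelie_compm1.
End RPreLieCategory.

Section ForgetfulFunctor.
Variables (k : fieldType) (p : nat) (hp : p \in [pchar k]).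

Section Map.
Variables (A B : dendType k) (f : dend_hom A B).
Let pPreLie_mul :
  {morph (f : pPreLie_of hp A -> pPreLie_of hp B) : x y / plmul x y}.
Proof.
move=> x y; rewrite [LHS](linear_sub (dend_fun_linear f)).
by rewrite dend_fun_prec dend_fun_succ.
Qed.
Let pPreLie_pmap :
  {morph (f : pPreLie_of hp A -> pPreLie_of hp B) : x / p_map x}.
Proof. exact: dend_hom_dpow. Qed.
Definition pPreLie_map : rprelie_hom (pPreLie_of hp A) (pPreLie_of hp B) :=
  @RPreLieHom k p (pPreLie_of hp A) (pPreLie_of hp B) f
    (dend_fun_linear f) pPreLie_mul pPreLie_pmap.
End Map.

Let pPreLie_map1 (A : dendType k) :
  pPreLie_map (dend_id A) = rprelie_id (pPreLie_of hp A).
Proof. exact: rprelie_hom_eq. Qed.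
Let pPreLie_map_comp (A B C : dendType k) (g : dend_hom B C)
  (f : dend_hom A B) :
  pPreLie_map (dend_comp g f) = rprelie_comp (pPreLie_map g) (pPreLie_map f).
Proof. exact: rprelie_hom_eq. Qed.

Definition pPreLie_functor : functor (dend_cat k) (rprelie_cat k p) :=
  @Functor (dend_cat k) (rprelie_cat k p) (fun A => pPreLie_of hp A)
    pPreLie_map pPreLie_map1 pPreLie_map_comp.
End ForgetfulFunctor.

Section EnvelopingFunctor.
Variables (k : fieldType) (p : nat).

Definition Rp_generator (P : rPreLieType k p) (g : free_dend P) : Prop :=
  (exists x y : P,
     g = dgen (plmul x y) - (dgen x ≻ dgen y - dgen y ≺ dgen x)) \/
  (exists x : P, g = dgen (p_map x) - dpow (dgen x) p).

Definition Rp (P : rPreLieType k p) : dendIdeal (free_dend P) :=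
  ideal_gen (@Rp_generator P).

Definition Up (P : rPreLieType k p) : dendType k := dend_quot (Rp P).

Section Map.
Variables (P Q : rPreLieType k p) (f : rprelie_hom P Q).

Definition free_dend_map : dend_hom (free_dend P) (free_dend Q) :=
  dlift (linear_comp (@dgen_linear k Q) (rprelie_fun_linear f)).

Lemma free_dend_map_gen x : free_dend_map (dgen x) = dgen (f x).
Proof. exact: dlift_gen. Qed.

Let Up_map_kill x :
  x \in Rp P -> dend_comp (qproj_hom (Rp Q)) free_dend_map x = 0.
Proof.
move: x; apply: ideal_gen_ker => g gR.
apply/qproj_eq0/mem_ideal_gen.
have fB := linear_sub (dend_fun_linear free_dend_map).
case: gR => [[u [v ->]]|[u ->]]; [left | right].
  exists (f u), (f v); rewrite !fB !dend_fun_prec !dend_fun_succ.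
  by rewrite !free_dend_map_gen rprelie_fun_mul.
exists (f u); rewrite fB dend_hom_dpow !free_dend_map_gen.
by rewrite rprelie_fun_pmap.
Qed.

Definition Up_map : dend_hom (Up P) (Up Q) := qlift Up_map_kill.

Lemma Up_mapE x : Up_map (qproj (Rp P) x) = qproj (Rp Q) (free_dend_map x).
Proof. exact: qliftE. Qed.
End Map.

Let Up_map1 (P : rPreLieType k p) : Up_map (rprelie_id P) = dend_id (Up P).
Proof.
apply: dend_hom_eq => x; rewrite -[x]qreprK Up_mapE.
have -> // : free_dend_map (rprelie_id P) = dend_id (free_dend P).
by apply/esym/dlift_unique.
Qed.

Let Up_map_comp (P Q R : rPreLieType k p) (g : rprelie_hom Q R)
  (f : rprelie_hom P Q) :
  Up_map (rprelie_comp g f) = dend_comp (Up_map g) (Up_map f).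
Proof.
apply: dend_hom_eq => x; rewrite -[x]qreprK Up_mapE.
have -> : dend_comp (Up_map g) (Up_map f) (qproj (Rp P) (qrepr x)) =
          qproj (Rp R) (free_dend_map g (free_dend_map f (qrepr x))).
  by rewrite -!Up_mapE.
have -> // : free_dend_map (rprelie_comp g f) =
             dend_comp (free_dend_map g) (free_dend_map f).
apply/esym/dlift_unique => y.
by rewrite -[LHS]/(free_dend_map g (free_dend_map f _)) !free_dend_map_gen.
Qed.

Definition Up_functor : functor (rprelie_cat k p) (dend_cat k) :=
  @Functor (rprelie_cat k p) (dend_cat k) Up (@Up_map) Up_map1 Up_map_comp.
End EnvelopingFunctor.

(* Main.v *)
Require Import Defs.
From mathcomp Require Import all_boot all_order all_algebra.

Set Implicit Arguments.
Unset Strict Implicit.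
Unset Printing Implicit Defensive.

Local Open Scope ring_scope.

(** The point is that U_p(P) carries a universal arrow from P. The generators
    of Dend(P), read modulo R_p, form a map eta : P -> U_p(P): it is linear
    because the generators are, and the two families of elements generating
    R_p are exactly what makes it respect the pre-Lie product and the p-map
    ([Up_unit]). Conversely a restricted pre-Lie morphism u : P -> A is in
    particular linear, so it extends to Dend(P) -> A by freeness; this extension
    sends each generator of the ideal R_p to 0, because u respects the product
    and the p-map, hence it factors through U_p(P) ([Up_ext]). The factorization
    is unique, since the image of P generates U_p(P) ([Up_hom_eq]).

    The rest is formal: a family of universal arrows c -> G (F c) that is
    natural in c makes F left adjoint to G ([universal_arrow_left_adjoint]),
    and the factorization through the universal arrow is the natural bijection
    of Hom sets ([universal_arrow_hom_bijection]). *)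

(* Arrows of a category, as opposed to linear maps. *)
Local Notation hom := Defs.hom.

Section UniversalArrow.
Local Open Scope cat_scope.
Variables (C D : category) (F : functor C D) (G : functor D C).
Variable eta : forall c : C, hom c (G (F c)).
Variable ext : forall (c : C) (d : D), hom c (G d) -> hom (F c) d.
Hypothesis eta_nat : forall (c c' : C) (f : hom c c'),
  fmap G (fmap F f) ∘ eta c = eta c' ∘ f.
Hypothesis extK : forall (c : C) (d : D) (u : hom c (G d)),
  fmap G (ext u) ∘ eta c = u.
Hypothesis eta_epi : forall (c : C) (d : D) (f g : hom (F c) d),
  fmap G f ∘ eta c = fmap G g ∘ eta c -> f = g.

Let fmap_F_eta (c c' : C) (d : D) (g : hom (F c') d) (f : hom c c') :
  fmap G (g ∘ fmap F f) ∘ eta c = fmap G g ∘ eta c' ∘ f.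
Proof. by rewrite fmap_comp -Defs.compA eta_nat Defs.compA. Qed.

Let fmap_eta (c : C) (d d' : D) (g : hom d d') (f : hom (F c) d) :
  fmap G (g ∘ f) ∘ eta c = fmap G g ∘ (fmap G f ∘ eta c).
Proof. by rewrite fmap_comp -Defs.compA. Qed.

(** The counit at [d] is the factorization of the identity of [G d]. The second
    triangle identity is then its defining property; naturality and the first
    triangle identity compare arrows out of some [F c], so it suffices to
    compare them after composition with [eta c]. *)
Lemma universal_arrow_left_adjoint : left_adjoint F G.
Proof.
exists eta, (fun d => ext (idm (G d))); split=> // [d d' g|c].
  by apply: eta_epi; rewrite fmap_eta fmap_F_eta !extK compm1 comp1m.
by apply: eta_epi; rewrite fmap_F_eta extK fmap1 !comp1m.
Qed.

Lemma universal_arrow_hom_bijection :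
  natural_hom_bijection (F := F) (G := G) ext.
Proof.
split=> [c d|c c' d f u|c d d' g u].
- exists (fun f => fmap G f ∘ eta c) => [u|f]; first exact: extK.
  by apply: eta_epi; rewrite extK.
- by apply: eta_epi; rewrite fmap_F_eta !extK.
- by apply: eta_epi; rewrite fmap_eta !extK.
Qed.

End UniversalArrow.

Section EnvelopingDendriform.
Variables (k : fieldType) (p : nat) (hp : p \in [pchar k]).

Section Unit.
Variable P : rPreLieType k p.

Definition Up_gen (x : P) : Up P := qproj (Rp P) (dgen x).

Lemma Up_gen_linear : linear Up_gen.
Proof. by move=> a x y; rewrite /Up_gen dgen_linear qproj_linear. Qed.

Let Up_gen_mul :
  {morph (Up_gen : P -> pPreLie_of hp (Up P)) : x y / plmul x y}.
Proof.
move=> x y; transitivity (qproj (Rp P) (dgen x ≻ dgen y - dgen y ≺ dgen x)).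
  by apply/qprojP/mem_ideal_gen; left; exists x, y.
by rewrite (linear_sub (@qproj_linear _ _ (Rp P))) qprojM_succ qprojM_prec.
Qed.

Let Up_gen_pmap : {morph (Up_gen : P -> pPreLie_of hp (Up P)) : x / p_map x}.
Proof.
move=> x; transitivity (qproj (Rp P) (dpow (dgen x) p)).
  by apply/qprojP/mem_ideal_gen; right; exists x.
exact: (dend_hom_dpow (qproj_hom (Rp P))).
Qed.

Definition Up_unit : rprelie_hom P (pPreLie_of hp (Up P)) :=
  @RPreLieHom k p P (pPreLie_of hp (Up P)) Up_gen
    Up_gen_linear Up_gen_mul Up_gen_pmap.

(** The image of P generates U_p(P): pulled back to Dend(P), both morphisms are
    the unique extension of the same linear map on P. *)
Lemma Up_hom_eq (A : dendType k) (f g : dend_hom (Up P) A) :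
  (forall x, f (Up_gen x) = g (Up_gen x)) -> f = g.
Proof.
move=> fg; apply: dend_hom_eq => x; rewrite -[x]qreprK.
have gl := linear_comp (dend_fun_linear g) Up_gen_linear.
have fE : dend_comp f (qproj_hom (Rp P)) = dlift gl by exact: dlift_unique.
have gE : dend_comp g (qproj_hom (Rp P)) = dlift gl by exact: dlift_unique.
by have := congr1 (fun h : dend_hom _ _ => h (qrepr x)) (etrans fE (esym gE)).
Qed.

End Unit.

Section Extension.
Variables (P : rPreLieType k p) (A : dendType k).
Variable u : rprelie_hom P (pPreLie_of hp A).

Let u_lift : dend_hom (free_dend P) A := @dlift k P A u (rprelie_fun_linear u).

Let u_lift_gen x : u_lift (dgen x) = u x. Proof. exact: dlift_gen. Qed.

(** On the two kinds of generators of R_p, vanishing is the compatibility of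
    [u] with the product and with the p-map of the restricted pre-Lie algebra
    of [A]. *)
Let u_lift_Rp x : x \in Rp P -> u_lift x = 0.
Proof.
move: x; apply: ideal_gen_ker => _ [[x [y ->]]|[x ->]];
  have uB := linear_sub (dend_fun_linear u_lift); apply/eqP.
  rewrite !uB dend_fun_succ dend_fun_prec !u_lift_gen GRing.subr_eq0.
  by apply/eqP; exact: (rprelie_fun_mul u).
rewrite uB dend_hom_dpow !u_lift_gen GRing.subr_eq0.
by apply/eqP; exact: (rprelie_fun_pmap u).
Qed.

Definition Up_ext : dend_hom (Up P) A := qlift u_lift_Rp.

Lemma Up_ext_gen x : Up_ext (Up_gen x) = u x.
Proof. exact: etrans (qliftE _ _) (u_lift_gen x). Qed.

End Extension.

Lemma Up_map_gen (P Q : rPreLieType k p) (f : rprelie_hom P Q) x :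
  Up_map f (Up_gen x) = Up_gen (f x).
Proof. by rewrite /Up_gen Up_mapE free_dend_map_gen. Qed.

End EnvelopingDendriform.

Theorem corollary5p5 (k : fieldType) (p : nat) (hp : p \in [pchar k]) :
  left_adjoint (Up_functor k p) (pPreLie_functor hp) /\
  exists Phi : forall (P : rPreLieType k p) (A : dendType k),
      rprelie_hom P (pPreLie_of hp A) -> dend_hom (Up P) A,
    natural_hom_bijection (F := Up_functor k p) (G := pPreLie_functor hp) Phi.
Proof.
pose F := Up_functor k p; pose G := pPreLie_functor hp.
pose eta (P : rprelie_cat k p) : hom P (G (F P)) := Up_unit hp P.
pose ext (P : rprelie_cat k p) (A : dend_cat k) (u : hom P (G A)) :
  hom (F P) A := Up_ext u.
have eta_nat (P Q : rprelie_cat k p) (f : hom P Q) :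
    mcomp (fmap G (fmap F f)) (eta P) = mcomp (eta Q) f.
  by apply: rprelie_hom_eq => x; exact: Up_map_gen.
have extK (P : rprelie_cat k p) (A : dend_cat k) (u : hom P (G A)) :
    mcomp (fmap G (ext P A u)) (eta P) = u.
  by apply: rprelie_hom_eq => x; exact: Up_ext_gen.
have eta_epi (P : rprelie_cat k p) (A : dend_cat k) (f g : hom (F P) A) :
    mcomp (fmap G f) (eta P) = mcomp (fmap G g) (eta P) -> f = g.
  move=> fg; apply: Up_hom_eq => x.
  by have := congr1 (fun h : rprelie_hom P (pPreLie_of hp A) => h x) fg.
split; first exact: (universal_arrow_left_adjoint eta_nat extK eta_epi).
by exists ext; exact: (universal_arrow_hom_bijection eta_nat extK eta_epi).
Qed.
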